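(* Let $G=(H,\sigma)$ be a linear oriented hypergraph. Then for every uniformly oriented hypergraph $U=(H,\sigma_U)$ with the same underlying hypergraph $H$, $\lambda_1(L(G))\le\lambda_1(L(U))$.
   Context: An oriented hypergraph $G=(H,\sigma)$ consists of a finite hypergraph $H=(V,E,\mathcal{I})$ with vertex set $V=\{v_1,\dots,v_n\}$, a finite set $E$ of edges, each edge a (possibly empty) subset of $V$, and incidence set $\mathcal{I}$, together with an incidence orientation $\sigma:\mathcal{I}\to\{+1,-1\}$. Throughout, hypergraphs are simple: $(v,e)\in\mathcal{I}$ if and only if $v\in e$, each such pair occurring once. $G$ is linear if $|e\cap f|\le 1$ for all distinct edges $e,f$. An edge $e$ is uniformly oriented if $\sigma(v,e)$ is the same for all $v\in e$; an oriented hypergraph is uniformly oriented if all its edges are. The degree $d_i$ of $v_i$ is the number of incidences containing $v_i$. For distinct $v_i,v_j\in e$, $\mathrm{sgn}_e(v_i,v_j)=-\sigma(v_i,e)\sigma(v_j,e)$. The adjacency matrix $A(G)=(a_{ij})$ has $a_{ij}=\sum_{e\in E:\, v_i,v_j\in e}\mathrm{sgn}_e(v_i,v_j)$ for $i\neq j$ and $a_{ii}=0$; $D(G)=\mathrm{diag}(d_1,\dots,d_n)$; the Laplacian is $L(G)=D(G)-A(G)$. $\lambda_1(M)$ denotes the largest eigenvalue of a real symmetric matrix $M$. *)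

(* Defs.v *)
From mathcomp Require Import all_boot all_order all_algebra.
From mathcomp Require Import complex polyrcf.
From mathcomp Require Import boolp classical_sets reals.

Set Implicit Arguments.
Unset Strict Implicit.
Unset Printing Implicit Defensive.

Import Order.TTheory GRing.Theory Num.Theory.
Local Open Scope ring_scope.

Definition hypergraph (n : nat) := {set {set 'I_n}}.

Definition incidences n (H : hypergraph n) : {set 'I_n * {set 'I_n}} :=
  [set p | (p.2 \in H) && (p.1 \in p.2)].

(* [orientation G v e] encodes sigma(v, e) = (-1) ^+ orientation G v e.  It is  *)
(* a total function, but only its values at incidences of G are ever used.      *)
Record oriented_hypergraph (n : nat) := OrientedHypergraph {
  underlying : hypergraph n;
  orientation : 'I_n -> {set 'I_n} -> bool
}.

Definition linear_hypergraph n (H : hypergraph n) : Prop :=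
  forall e f : {set 'I_n}, e \in H -> f \in H -> e != f -> (#|e :&: f| <= 1)%N.

Definition uniformly_oriented_edge n (G : oriented_hypergraph n)
    (e : {set 'I_n}) : Prop :=
  forall v w, v \in e -> w \in e -> orientation G v e = orientation G w e.

Definition uniformly_oriented n (G : oriented_hypergraph n) : Prop :=
  forall e, e \in underlying G -> uniformly_oriented_edge G e.

Section Matrices.
Variables (R : realType) (n : nat) (G : oriented_hypergraph n).

Definition sigma (v : 'I_n) (e : {set 'I_n}) : R := (-1) ^+ orientation G v e.

Definition sgn (e : {set 'I_n}) (v w : 'I_n) : R := - (sigma v e * sigma w e).

Definition degree (v : 'I_n) : nat :=
  #|[set p in incidences (underlying G) | p.1 == v]|.

Definition adjacency : 'M[R]_n :=
  \matrix_(i, j) if i == j then 0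
    else \sum_(e in underlying G | (i \in e) && (j \in e)) sgn e i j.

Definition degree_mx : 'M[R]_n := diag_mx (\row_i (degree i)%:R).

Definition laplacian : 'M[R]_n := degree_mx - adjacency.

Lemma laplacian_sym : laplacian^T = laplacian.
Proof.
rewrite /laplacian linearB /= tr_diag_mx; congr (_ - _).
apply/matrixP => i j; rewrite !mxE eq_sym; case: ifP => // _.
by apply: eq_big => [e|e _]; rewrite 1?[(j \in e) && _]andbC // /sgn mulrC.
Qed.

End Matrices.

Section LargestEigenvalue.
Variable R : realType.

Definition largest_eigenvalue n (M : 'M[R]_n) (a : R) : Prop :=
  eigenvalue M a /\ forall b, eigenvalue M b -> b <= a.

(* [xget 0 A] is an element of A if A is nonempty, and 0 otherwise.  For a      *)
(* symmetric M with n > 0 the largest eigenvalue exists and is unique: see      *)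
(* [lambda1P] and [largest_eigenvalue_uniq].                                    *)
Definition lambda1 n (M : 'M[R]_n) : R :=
  xget 0 [set a | largest_eigenvalue M a]%classic.

Lemma largest_eigenvalue_uniq n (M : 'M[R]_n) a b :
  largest_eigenvalue M a -> largest_eigenvalue M b -> a = b.
Proof.
by move=> [Ma maxa] [Mb maxb]; apply/le_anti; rewrite maxb // maxa.
Qed.

Lemma symmetric_eigenvalue_exists n (M : 'M[R]_n) :
  (0 < n)%N -> M^T = M -> exists a, eigenvalue M a.
Proof.
move=> n0 symM; set f := real_complex R.
have [|c] := closed_rootP (map_poly f (char_poly M)) _.
  by rewrite size_map_poly size_char_poly eqSS -lt0n.
move=> rc; have := rc; rewrite map_char_poly -eigenvalue_root_char.
move=> /eigenvalueP[v vM v0].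
pose cj m k (A : 'M[R[i]]_(m, k)) := (map_mx Num.conj A)^T.
have cjM m k l (A : 'M[R[i]]_(m, k)) (B : 'M_(k, l)) :
    cj _ _ (A *m B) = cj _ _ B *m cj _ _ A by rewrite /cj map_mxM trmx_mul.
have cjK m k (A : 'M[R[i]]_(m, k)) : cj _ _ (cj _ _ A) = A.
  by apply/matrixP => i j; rewrite !mxE conjCK.
have cjf : cj _ _ (map_mx f M) = map_mx f M.
  apply/matrixP => i j; rewrite !mxE.
  have -> : M j i = M i j by move: symM => /matrixP/(_ i j); rewrite mxE.
  by apply/CrealP; rewrite complex_real.
have s0 : (v *m cj _ _ v) 0 0 != 0.
  apply: contra v0 => /eqP; rewrite mxE => s0.
  apply/eqP/matrixP => i j; rewrite ord1 [RHS]mxE; apply/eqP.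
  rewrite -normr_eq0 -sqrf_eq0.
  have /psumr_eq0P-> // : \sum_k `|v 0 k| ^+ 2 = 0.
    by rewrite -[RHS]s0; apply: eq_bigr => k _; rewrite normCK !mxE.
  by move=> k _; rewrite exprn_ge0.
have : cj _ _ (v *m map_mx f M *m cj _ _ v) = v *m map_mx f M *m cj _ _ v.
  by rewrite !cjM cjK cjf mulmxA.
rewrite vM -scalemxAl.
have cjZ m k (A : 'M[R[i]]_(m, k)) : cj _ _ (c *: A) = c^* *: cj _ _ A.
  by apply/matrixP => i j; rewrite !mxE rmorphM.
rewrite cjZ cjM cjK.
move=> /matrixP/(_ 0 0); rewrite [LHS]mxE [RHS]mxE => /(mulIf s0)/CrealP creal.
have /complex_realP[a ca] := creal.
by exists a; rewrite eigenvalue_root_char -(fmorph_root f) /= -ca.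
Qed.

Lemma lambda1P n (M : 'M[R]_n) :
  (0 < n)%N -> M^T = M -> largest_eigenvalue M (lambda1 M).
Proof.
move=> n0 symM; apply: (@xgetPex _ 0 [set a | largest_eigenvalue M a]%classic).
have p0 : char_poly M != 0 by rewrite monic_neq0 // char_poly_monic.
have inP a : eigenvalue M a = (a \in rootsR (char_poly M)).
  by rewrite eigenvalue_root_char -(roots_on_rootsR p0) /= ?inE.
have [a0] := symmetric_eigenvalue_exists n0 symM; rewrite inP => a0s.
have [a [as_ amax]] : exists a, a \in rootsR (char_poly M) /\
    forall b, b \in rootsR (char_poly M) -> b <= a.
  elim: (rootsR _) a0 a0s => // x s IHs a0 _.
  case: s IHs => [|y s] IHs.
    by exists x; split=> [|b]; rewrite inE // => /eqP->.
  have [a [as_ amax]] := IHs y (mem_head y s).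
  exists (Num.max x a); split=> [|b].
    by rewrite /Num.max; case: ifP => _; rewrite inE ?as_ ?orbT ?eqxx.
  by rewrite inE le_max => /predU1P[->|/amax->]; rewrite ?lexx ?orbT.
by exists a; split=> [|b]; rewrite inP // => /amax.
Qed.

End LargestEigenvalue.

(* Main.v *)
(* L(G) and L(U) have the same diagonal, and the entry of L(U) at (i, j) counts
   the common edges of i and j, hence bounds the absolute value of the entry of
   L(G).  If x is an eigenvector of L(G) for its largest eigenvalue, the
   Rayleigh quotient of L(U) at the vector of the |x_i| is therefore at least
   the Rayleigh quotient of L(G) at x. *)

Require Import Defs.
From mathcomp Require Import all_boot all_order all_algebra.
From mathcomp Require Import complex.
From mathcomp Require Import reals.
Set Implicit Arguments.
Unset Strict Implicit.
Unset Printing Implicit Defensive.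

Import Order.TTheory GRing.Theory Num.Theory.
Local Open Scope ring_scope.
Local Open Scope sesquilinear_scope.
Local Open Scope complex_scope.

(** Writing [A] as P^-1 D P with P unitary gives P A = D P, so row [j] of P is a left eigenvector
    for the [j]-th diagonal entry of D; it is nonzero because P is invertible. *)
Lemma spectral_diag_eigenvalue (C : numClosedFieldType) n (A : 'M[C]_n) j :
  A \is normalmx -> eigenvalue A (spectral_diag A 0 j).
Proof.
move=> /orthomx_spectralP defA; have Punit := spectral_unit A.
apply/eigenvalueP; exists (row j (spectralmx A)).
  by rewrite -row_mul {2}defA !mulmxA mulmxV // mul1mx; apply/rowP => k;
    rewrite mul_diag_mx !mxE.
apply/eqP => row0; have /rowP/(_ j) : row j (1%:M : 'M[C]_n) = 0.
  by rewrite -(mulmxV Punit) row_mul row0 mul0mx.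
by rewrite !mxE eqxx => /eqP; rewrite oner_eq0.
Qed.

(** Over the complex numbers [M] becomes Hermitian, hence unitarily diagonalizable. In an
    orthonormal eigenbasis the quadratic form is the sum of the eigenvalues weighted by the squared
    moduli of the coordinates of [x]. *)
Lemma rayleigh_le (R : rcfType) n (M : 'M[R]_n) (mu : R) (x : 'rV[R]_n) :
    M^T = M -> (forall a, eigenvalue M a -> a <= mu) ->
  (x *m M *m x^T) 0 0 <= mu * (x *m x^T) 0 0.
Proof.
move=> symM maxmu; pose f := real_complex R; pose A := map_mx f M.
have fconj m k (B : 'M[R]_(m, k)) : map_mx Num.conj (map_mx f B) = map_mx f B.
  by apply/matrixP => i j; rewrite !mxE; apply/CrealP; rewrite complex_real.
have Aherm : A \is hermsymmx.
  by apply/is_hermitianmxP; rewrite expr0 scale1r /A map_trmx symM fconj.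
have Anormal := hermitian_normalmx Aherm.
(* The entry is real since [A] is Hermitian, and it is a root of the characteristic polynomial of
   [M] mapped along [f]; hence it comes from an eigenvalue of [M] itself. *)
have diag_le j : spectral_diag A 0 j <= f mu.
  have /mxOverP/(_ 0 j)/complex_realP[r dr] := hermitian_spectral_diag_real Aherm.
  rewrite dr lecR maxmu //.
  have := spectral_diag_eigenvalue j Anormal.
  by rewrite dr !eigenvalue_root_char -map_char_poly fmorph_root.
pose P := spectralmx A; have Punitary : P \is unitarymx := spectral_unitarymx A.
(* Coordinates of [x] in the orthonormal basis formed by the rows of [P]. *)
pose w := map_mx f x *m P^t*.
have wE : w^t* = P *m map_mx f x^T.
  by rewrite /w trmx_mul map_mxM trmxCK map_trmx fconj.
have quadE : f ((x *m M *m x^T) 0 0) =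
    \sum_j spectral_diag A 0 j * `|w 0 j| ^+ 2.
  have -> : f ((x *m M *m x^T) 0 0) =
      (w *m diag_mx (spectral_diag A) *m w^t*) 0 0.
    have -> : f ((x *m M *m x^T) 0 0) = map_mx f (x *m M *m x^T) 0 0.
      by rewrite [RHS]mxE.
    rewrite wE /w -(invmx_unitary Punitary) !map_mxM -/A.
    by rewrite [in LHS](orthomx_spectralP Anormal) !mulmxA.
  rewrite mxE; apply: eq_bigr => j _.
  by rewrite mul_mx_diag normCK !mxE mulrCA mulrA.
have normE : f ((x *m x^T) 0 0) = \sum_j `|w 0 j| ^+ 2.
  have -> : f ((x *m x^T) 0 0) = (w *m w^t*) 0 0.
    rewrite wE /w mulmxA -(invmx_unitary Punitary) mulmxKV ?spectral_unit //.
    by rewrite -map_mxM [RHS]mxE.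
  by rewrite mxE; apply: eq_bigr => j _; rewrite normCK !mxE.
rewrite -lecR rmorphM /= -[X in X <= _]/(f _) -[X in _ * X]/(f _).
rewrite quadE normE mulr_sumr.
by apply: ler_sum => j _; rewrite ler_wpM2r ?exprn_ge0.
Qed.

Lemma lambda1_le_dominated (R : realType) n (M N : 'M[R]_n) :
    M^T = M -> N^T = N -> (forall i j, `|M i j| <= N i j) ->
  lambda1 M <= lambda1 N.
Proof.
(* In dimension 0 there is only one matrix, so both sides coincide. *)
case: n M N => [|n] M N symM symN leMN; first by rewrite (flatmx0 M) (flatmx0 N).
have [/eigenvalueP[x xM x0] _] := lambda1P (ltn0Sn n) symM.
have [_ maxN] := lambda1P (ltn0Sn n) symN.
pose y : 'rV[R]_n.+1 := map_mx Num.norm x.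
have yy : (y *m y^T) 0 0 = (x *m x^T) 0 0.
  rewrite !mxE; apply: eq_bigr => j _; rewrite !mxE -normrM ger0_norm //.
  by rewrite -expr2 sqr_ge0.
have xx_gt0 : 0 < (x *m x^T) 0 0.
  have [j xj] : exists j, x 0 j != 0 by apply/rV0Pn.
  rewrite mxE (bigD1 j) //= ltr_pwDl ?mxE ?sumr_ge0 // => [|k _].
    by rewrite -expr2 exprn_even_gt0.
  by rewrite mxE -expr2 sqr_ge0.
(* As [x] and [y] have the same positive squared norm, comparing the two quadratic forms
   suffices. *)
rewrite -(ler_pM2r xx_gt0) -[in leRHS]yy.
apply: le_trans (rayleigh_le y symN maxN).
have -> : lambda1 M * (x *m x^T) 0 0 = (x *m M *m x^T) 0 0.
  by rewrite xM -scalemxAl [RHS]mxE.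
rewrite !mxE; apply: ler_sum => j _; rewrite !mxE.
apply: le_trans (ler_norm _) _; rewrite normrM ler_wpM2r //.
apply: le_trans (ler_norm_sum _ _ _) _; apply: ler_sum => k _.
by rewrite !mxE normrM ler_wpM2l.
Qed.

Lemma norm_sigma (R : realType) n (G : oriented_hypergraph n) v e :
  `|sigma R G v e| = 1.
Proof. by rewrite /sigma normr_sign. Qed.

Lemma sgn_uniform (R : realType) n (G : oriented_hypergraph n) e v w :
  uniformly_oriented_edge G e -> v \in e -> w \in e -> sgn R G e v w = -1.
Proof.
by move=> unif ve we; rewrite /sgn /sigma (unif v w) // -expr2 sqrr_sign.
Qed.

Lemma norm_laplacian_le (R : realType) n (G U : oriented_hypergraph n) :
    underlying U = underlying G -> uniformly_oriented U ->
  forall i j, `|laplacian R G i j| <= laplacian R U i j.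
Proof.
move=> UG unifU i j; rewrite !mxE.
(* Diagonal entries are degrees, which depend only on the underlying hypergraph. *)
case: eqVneq => [_|_]; first by rewrite /degree UG !subr0 mulr1n normr_nat.
(* Off the diagonal, each common edge contributes a sign to L(G) and +1 to L(U). *)
rewrite !mulr0n !sub0r normrN UG; apply: le_trans (ler_norm_sum _ _ _) _.
rewrite -sumrN; apply: ler_sum => e /and3P[eG ie je].
have eU : e \in underlying U by rewrite UG.
by rewrite (sgn_uniform R (unifU e eU) ie je) opprK /sgn normrN normrM
  !norm_sigma mulr1.
Qed.

Theorem theorem4p6 (R : realType) (n : nat) (G : oriented_hypergraph n) :
  linear_hypergraph (underlying G) ->
  forall U : oriented_hypergraph n,
    underlying U = underlying G -> uniformly_oriented U ->
    lambda1 (laplacian R G) <= lambda1 (laplacian R U).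
Proof.
move=> _ U UG unifU.
apply: lambda1_le_dominated; rewrite ?laplacian_sym //.
exact: norm_laplacian_le.
Qed.
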